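(* Let $N\ge 2$, let $f_1,\dots,f_N:\mathbb{R}^n\to\mathbb{R}$ be convex, let $F=\sum_{i=1}^N f_i$, and let $D$ be a symmetric positive definite $n\times n$ matrix. Suppose that $F$ has a unique minimum point $x^*$ and that there is a constant $\alpha>0$ such that $F(x)-F(x^* )\ge \alpha\|x-x^*\|_D^2$ for all $x\in\mathbb{R}^n$. Fix $\beta\in(0,1)$ and the initial data of the Selective Linearization (SLIN) algorithm (the starting point $x^1$, the index $j_1$, and the initial linearization points $z_i^1$ and subgradients $g_i^1$, $i\neq j_1$). Then there is a constant $C'>0$, which may depend on the functions $f_i$, on $D$, on $\beta$ and on the initial data but not on $\varepsilon$, such that for every $\varepsilon\in(0,1/2]$ the SLIN algorithm with stopping precision $\varepsilon$ stops (that is, satisfies $F(x^k)-\tilde F^k(z^k_{j_k})\le\varepsilon$), and the total number of its iterations (descent steps and null steps together) is at most $$C'\,\frac{1}{\varepsilon}\ln\frac{1}{\varepsilon}.$$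
   Context: Notation: $\|x\|_D=\langle x,Dx\rangle^{1/2}$. SLIN algorithm (stopping precision $\varepsilon$, parameter $\beta\in(0,1)$), for minimizing $F=\sum_{i=1}^N f_i$: Step 0. Set $k=1$, choose $j_1\in\{1,\dots,N\}$, $x^1\in\mathbb{R}^n$, and for all $i\ne j_1$ points $z_i^1\in\mathbb{R}^n$ and subgradients $g_i^1\in\partial f_i(z_i^1)$. At every iteration, put $\tilde f_i^k(x)=f_i(z_i^k)+\langle g_i^k,x-z_i^k\rangle$ and $\tilde F^k(x)=f_{j_k}(x)+\sum_{i\neq j_k}\tilde f_i^k(x)$. Step 1. Let $z^k_{j_k}$ be the (unique) solution of $\min_x \tilde F^k(x)+\frac12\|x-x^k\|_D^2$, and set $g^k_{j_k}=-\sum_{i\ne j_k}g_i^k-D(z^k_{j_k}-x^k)$ (this is a subgradient of $f_{j_k}$ at $z^k_{j_k}$). Step 2. If $F(x^k)-\tilde F^k(z^k_{j_k})\le\varepsilon$, stop. Otherwise continue. Step 3. If $F(z^k_{j_k})\le F(x^k)-\beta\big(F(x^k)-\tilde F^k(z^k_{j_k})\big)$, set $x^{k+1}=z^k_{j_k}$ (descent step); otherwise set $x^{k+1}=x^k$ (null step). Step 4. Select $j_{k+1}\in\arg\max_{i\ne j_k}\{f_i(z^k_{j_k})-\tilde f_i^k(z^k_{j_k})\}$. For all $i\ne j_{k+1}$ set $z_i^{k+1}=z_i^k$, $g_i^{k+1}=g_i^k$ (so $\tilde f_i^{k+1}\equiv\tilde f_i^k$; for $i=j_k$ this uses $z^k_{j_k},g^k_{j_k}$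 from Step 1). Increase $k$ by 1 and go to Step 1. *)

(* Defs.v *)
From mathcomp Require Import all_boot all_order all_algebra.
From mathcomp Require Import all_classical all_reals all_analysis.

Set Implicit Arguments.
Unset Strict Implicit.
Unset Printing Implicit Defensive.

Import Order.TTheory GRing.Theory Num.Theory.
Local Open Scope ring_scope.

(* Points of R^n are row vectors, so the matrix-vector product D x is the row
   (D *m x^T)^T = x *m D^T. *)

Definition dotrv (R : realType) (n : nat) (u v : 'rV[R]_n) : R :=
  (u *m v^T) 0 0.

Definition mulmv (R : realType) (n : nat) (D : 'M[R]_n) (x : 'rV[R]_n) :
  'rV[R]_n := (D *m x^T)^T.

Definition normD (R : realType) (n : nat) (D : 'M[R]_n) (x : 'rV[R]_n) : R :=
  Num.sqrt (dotrv x (mulmv D x)).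

Definition sym_posdef (R : realType) (n : nat) (D : 'M[R]_n) : Prop :=
  D^T = D /\ forall x : 'rV[R]_n, x != 0 -> 0 < dotrv x (mulmv D x).

Definition minimizer (R : realType) (n : nat) (h : 'rV[R]_n -> R)
  (x : 'rV[R]_n) : Prop := forall y, h x <= h y.

Definition subgradient (R : realType) (n : nat) (h : 'rV[R]_n -> R)
  (z g : 'rV[R]_n) : Prop := forall y, h z + dotrv g (y - z) <= h y.

Section SLIN.
Variables (R : realType) (n N : nat).
Implicit Types (f : 'I_N -> 'rV[R]_n -> R) (D : 'M[R]_n).
Implicit Types (j : 'I_N) (z g : 'I_N -> 'rV[R]_n).

Definition Fsum f (x : 'rV[R]_n) : R := \sum_i f i x.

Definition linearization f z g (i : 'I_N) (x : 'rV[R]_n) : R :=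
  f i (z i) + dotrv (g i) (x - z i).

(* The entries z j and g j at the selected index are not used. *)
Definition Fmodel f j z g (x : 'rV[R]_n) : R :=
  f j x + \sum_(i < N | i != j) linearization f z g i x.

Section Run.
Variables (f : 'I_N -> 'rV[R]_n -> R) (D : 'M[R]_n) (beta eps : R).
Variables (x1 : 'rV[R]_n) (j1 : 'I_N) (z1 g1 : 'I_N -> 'rV[R]_n).
Variables (x : nat -> 'rV[R]_n) (j : nat -> 'I_N).
Variables (z g : nat -> 'I_N -> 'rV[R]_n).

(* Iterations are numbered from 0: index k holds the data of iteration k + 1.
   The entries z k (j k), g k (j k) are those computed in Step 1. *)

Definition model_at (k : nat) : 'rV[R]_n -> R :=
  Fmodel f (j k) (z k) (g k).

Definition trial (k : nat) : 'rV[R]_n := z k (j k).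

Definition gap (k : nat) : R := Fsum f (x k) - model_at k (trial k).

Definition stops_at (k : nat) : Prop := gap k <= eps.

Definition reached (k : nat) : Prop :=
  forall l, (l < k)%N -> ~ stops_at l.

(* [slin_run] says that the sequences are produced by the algorithm up to the
   iteration at which it stops, if there is one; nothing is required of the
   sequences after that iteration.  Ties in the choice of j k.+1 may be broken
   arbitrarily.  That g k (j k) is a subgradient of f (j k) is a consequence of
   Step 1, not a requirement. *)
Record slin_run : Prop := SlinRun {
  run_x0 : x 0%N = x1;
  run_j0 : j 0%N = j1;
  run_zg0 : forall i, i != j1 -> z 0%N i = z1 i /\ g 0%N i = g1 i;
  run_trial : forall k, reached k ->
    minimizer (fun y => model_at k y + 2^-1 * normD D (y - x k) ^+ 2)
      (trial k);
  run_trial_subgrad : forall k, reached k ->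
    g k (j k) =
      - (\sum_(i < N | i != j k) g k i) - mulmv D (trial k - x k);
  run_center : forall k, reached k.+1 ->
    x k.+1 = if Fsum f (trial k) <= Fsum f (x k) - beta * gap k
             then trial k else x k;
  run_select : forall k, reached k.+1 ->
    j k.+1 != j k /\
    forall i, i != j k ->
      f i (trial k) - linearization f (z k) (g k) i (trial k) <=
      f (j k.+1) (trial k)
        - linearization f (z k) (g k) (j k.+1) (trial k);
  run_keep : forall k, reached k.+1 -> forall i, i != j k.+1 ->
    z k.+1 i = z k i /\ g k.+1 i = g k i
}.

End Run.
End SLIN.

(* Main.v *)
Require Import Defs.
From mathcomp Require Import all_boot all_order all_algebra.
From mathcomp Require Import all_classical all_reals all_analysis.
From mathcomp Require Import ring lra.

(** Let [w k] be the gap between [F (x k)] and the optimal value of the [k]-th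
    proximal subproblem.  A trial point also minimizes the proximal objective
    in which every [f i] is linearized, so comparing consecutive subproblems
    gives, after a null step, [w k.+1 <= w k - c * w k ^+ 2]: replacing the
    worst linearization raises the optimal value.  The constant [c] is uniform
    because the centers stay in a bounded level set, [w] stays bounded along the
    run, hence the trial points and the subgradients are bounded.  Each series
    of null steps thus has [O(1 / eps)] steps.  By the growth condition a
    descent step contracts [F (x k) - F xstar] by a constant factor, while this
    quantity is at least [beta * eps] before every descent step: there are
    [O(ln (1 / eps))] of them. *)

Set Implicit Arguments.
Unset Strict Implicit.
Unset Printing Implicit Defensive.

Import Order.TTheory GRing.Theory Num.Theory.
Import numFieldNormedType.Exports.
Local Open Scope classical_set_scope.
Local Open Scope ring_scope.

(** * The inner product of D *)

Section DotProduct.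
Variables (R : realType) (n : nat).
Implicit Types u v w : 'rV[R]_n.

Lemma dotrvE u v : dotrv u v = \sum_i u 0 i * v 0 i.
Proof. by rewrite /dotrv mxE; apply: eq_bigr => i _; rewrite mxE. Qed.

Lemma dotrvC u v : dotrv u v = dotrv v u.
Proof. by rewrite !dotrvE; apply: eq_bigr => i _; rewrite mulrC. Qed.

Lemma dotrvDr u v w : dotrv u (v + w) = dotrv u v + dotrv u w.
Proof. by rewrite /dotrv linearD mulmxDr mxE. Qed.

Lemma dotrvZr a u v : dotrv u (a *: v) = a * dotrv u v.
Proof. by rewrite /dotrv linearZ -scalemxAr mxE. Qed.

Lemma dotrvNr u v : dotrv u (- v) = - dotrv u v.
Proof. by rewrite -scaleN1r dotrvZr mulN1r. Qed.

Lemma dotrvBr u v w : dotrv u (v - w) = dotrv u v - dotrv u w.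
Proof. by rewrite dotrvDr dotrvNr. Qed.

Lemma dotrvDl u v w : dotrv (v + w) u = dotrv v u + dotrv w u.
Proof. by rewrite !(dotrvC _ u) dotrvDr. Qed.

Lemma dotrvNl u v : dotrv (- v) u = - dotrv v u.
Proof. by rewrite !(dotrvC _ u) dotrvNr. Qed.

Lemma dotrv0r u : dotrv u 0 = 0.
Proof. by rewrite -(scale0r u) dotrvZr mul0r. Qed.

Lemma dotrv_suml (I : finType) (P : pred I) (G : I -> 'rV[R]_n) u :
  dotrv (\sum_(i | P i) G i) u = \sum_(i | P i) dotrv (G i) u.
Proof. by rewrite /dotrv mulmx_suml summxE. Qed.

End DotProduct.

Section DNorm.
Variables (R : realType) (n : nat) (D : 'M[R]_n).
Hypothesis hD : sym_posdef D.
Implicit Types u v w : 'rV[R]_n.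

Definition dotD u v := dotrv u (mulmv D v).

Lemma mulmvE u : mulmv D u = u *m D.
Proof. by rewrite /mulmv trmx_mul trmxK hD.1. Qed.

Lemma dotDC u v : dotD u v = dotD v u.
Proof.
rewrite /dotD !mulmvE /dotrv !trmx_mul hD.1 mulmxA.
rewrite -[in LHS](trmxK (u *m D *m _)).
by rewrite mxE !trmx_mul trmxK hD.1 mulmxA.
Qed.

Lemma dotDDr u v w : dotD u (v + w) = dotD u v + dotD u w.
Proof. by rewrite /dotD !mulmvE mulmxDl dotrvDr. Qed.

Lemma dotDZr a u v : dotD u (a *: v) = a * dotD u v.
Proof. by rewrite /dotD !mulmvE -scalemxAl dotrvZr. Qed.

Lemma dotD0r u : dotD u 0 = 0.
Proof. by rewrite -(scale0r u) dotDZr mul0r. Qed.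

Lemma dotDNr u v : dotD u (- v) = - dotD u v.
Proof. by rewrite -scaleN1r dotDZr mulN1r. Qed.

Lemma dotDDl u v w : dotD (v + w) u = dotD v u + dotD w u.
Proof. by rewrite !(dotDC _ u) dotDDr. Qed.

Lemma dotDZl a u v : dotD (a *: v) u = a * dotD v u.
Proof. by rewrite !(dotDC _ u) dotDZr. Qed.

Lemma dotDNl u v : dotD (- v) u = - dotD v u.
Proof. by rewrite !(dotDC _ u) dotDNr. Qed.

Lemma dotD_ge0 u : 0 <= dotD u u.
Proof.
have [->|u0] := eqVneq u 0; last exact/ltW/hD.2.
by rewrite dotD0r.
Qed.

Lemma normD_sqr u : normD D u ^+ 2 = dotD u u.
Proof. by rewrite sqr_sqrtr ?dotD_ge0. Qed.

Lemma normD_ge0 u : 0 <= normD D u.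
Proof. exact: sqrtr_ge0. Qed.

Lemma normD0 : normD D 0 = 0.
Proof. by rewrite /normD -/(dotD _ _) dotD0r sqrtr0. Qed.

Lemma normDZ a u : normD D (a *: u) = `|a| * normD D u.
Proof.
rewrite /normD -/(dotD _ _) dotDZr dotDZl mulrA -expr2 sqrtrM ?sqr_ge0//.
by rewrite sqrtr_sqr.
Qed.

Lemma normDN u : normD D (- u) = normD D u.
Proof. by rewrite -scaleN1r normDZ normrN1 mul1r. Qed.

Lemma distDC u v : normD D (u - v) = normD D (v - u).
Proof. by rewrite -opprB normDN. Qed.

Lemma normD_sqrD u v :
  normD D (u + v) ^+ 2 = normD D u ^+ 2 + 2 * dotD u v + normD D v ^+ 2.
Proof. by rewrite !normD_sqr dotDDl !dotDDr (dotDC v u); ring. Qed.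

Lemma normD_eq0 u : (normD D u == 0) = (u == 0).
Proof.
apply/idP/eqP => [|->]; last by rewrite normD0.
have [//|u0] := eqVneq u 0; have := hD.2 _ u0.
by rewrite sqrtr_eq0 => /lt_geF ->.
Qed.

(** Cauchy-Schwarz, from the nonnegative square of [normD D v ^+ 2 *: u - dotD u v *: v]. *)
Lemma dotD_le u v : dotD u v <= normD D u * normD D v.
Proof.
have [->|v0] := eqVneq v 0.
  by rewrite normD0 mulr0 dotD0r.
have vp : 0 < normD D v by rewrite lt_neqAle normD_ge0 eq_sym normD_eq0 v0.
have := dotD_ge0 (normD D v ^+ 2 *: u + (- dotD u v) *: v).
rewrite dotDDl !dotDDr !dotDZl !dotDZr (dotDC v u) -!normD_sqr.
have -> : normD D v ^+ 2 * (normD D v ^+ 2 * normD D u ^+ 2) +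
  normD D v ^+ 2 * (- dotD u v * dotD u v) +
  (- dotD u v * (normD D v ^+ 2 * dotD u v) +
   - dotD u v * (- dotD u v * normD D v ^+ 2)) =
  normD D v ^+ 2 * ((normD D u * normD D v) ^+ 2 - dotD u v ^+ 2) by ring.
rewrite pmulr_rge0 ?exprn_gt0// subr_ge0 => h.
apply: le_trans (ler_norm _) _; rewrite -ler_sqr ?nnegrE ?mulr_ge0 ?normD_ge0//.
by rewrite real_normK ?num_real.
Qed.

Lemma ler_normDD u v : normD D (u + v) <= normD D u + normD D v.
Proof.
rewrite -ler_sqr ?nnegrE ?addr_ge0 ?normD_ge0// normD_sqrD sqrrD.
by have := dotD_le u v; lra.
Qed.

Lemma ler_normD_sum (I : finType) (F : I -> 'rV[R]_n) :
  normD D (\sum_i F i) <= \sum_i normD D (F i).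
Proof.
elim/big_ind2 : _ => [|u a v b ha hb|i _]; rewrite ?normD0//.
by apply: le_trans (ler_normDD _ _) _; rewrite lerD.
Qed.

Lemma sym_posdef_unit : D \in unitmx.
Proof.
rewrite -row_free_unit; apply: inj_row_free => v hv; apply/eqP.
apply/negPn/negP => /hD.2; rewrite mulmvE hv.
by rewrite /dotrv trmx0 mulmx0 mxE ltxx.
Qed.

Lemma dotrv_bounded u : exists2 c : R, 0 <= c &
  forall v, dotrv u v <= c * normD D v.
Proof.
exists (normD D (u *m invmx D)) => [|v]; first exact: normD_ge0.
apply: le_trans (dotD_le _ _).
by rewrite dotDC /dotD mulmvE mulmxKV ?sym_posdef_unit// dotrvC.
Qed.

(** Links the [D]-norm with coordinates, hence with the topology in which limits are taken. *)
Lemma coord_bounded : exists2 c : R, 0 <= c &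
  forall v i, `|v 0 i| <= c * normD D v.
Proof.
have h i : exists c : R, 0 <= c /\
      forall v, dotrv (delta_mx 0 i) v <= c * normD D v.
  by have [c c0 hc] := dotrv_bounded (delta_mx 0 i); exists c.
have [c hc] := choice h.
exists (\sum_i c i) => [|v i]; first by apply: sumr_ge0 => i _; apply: (hc i).1.
have e u : dotrv (delta_mx 0 i) u = u 0 i.
  rewrite dotrvE (bigD1 i)//= mxE !eqxx mul1r big1 ?addr0// => k ki.
  by rewrite mxE (negbTE ki) andbF mul0r.
apply: (@le_trans _ _ (c i * normD D v)).
  rewrite ler_norml; apply/andP; split; last by rewrite -e; apply: (hc i).2.
  by rewrite lerNl -e -dotrvNr -normDN; apply: (hc i).2.
rewrite ler_wpM2r ?normD_ge0// (bigD1 i)//= lerDl.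
by apply: sumr_ge0 => k _; apply: (hc k).1.
Qed.

End DNorm.

(** * Convex functions on row vectors *)

Section Convex.
Variables (R : realType) (n : nat).
Implicit Types (u v w x y : 'rV[R]_n) (h : 'rV[R]_n -> R).

(** Convexity with a bare real weight, suited to linear arithmetic, in place of the interval-typed
    weight of [convex_function]. *)
Definition cvxfun h := forall t x y, 0 <= t -> t <= 1 ->
  h (t *: x + (1 - t) *: y) <= t * h x + (1 - t) * h y.

Lemma convex_function_cvxfun h :
  convex_function [set: convex_lmodType 'rV[R]_n] h -> cvxfun h.
Proof.
by move=> ch t x y t0 t1; apply: (ch (Itv01 t0 t1)); rewrite inE.
Qed.

Lemma cvxfunD h1 h2 : cvxfun h1 -> cvxfun h2 -> cvxfun (fun y => h1 y + h2 y).
Proof.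
move=> c1 c2 t x y t0 t1; have := c1 t x y t0 t1; have := c2 t x y t0 t1.
lra.
Qed.

Lemma cvxfun_affine h z a : (forall y, h y = h z + dotrv a (y - z)) -> cvxfun h.
Proof.
move=> hE t x y t0 t1; rewrite hE (hE x) (hE y).
by rewrite !dotrvBr dotrvDr !dotrvZr le_eqVlt; apply/orP; left; apply/eqP; ring.
Qed.

Lemma cvx_line_bounded h v r : cvxfun h -> 0 < r ->
  exists B, forall t, `|t| <= r -> h (t *: v) <= B.
Proof.
move=> ch r0; exists (Num.max (h (r *: v)) (h ((- r) *: v))) => t.
rewrite ler_norml => /andP[t1 t2].
set s := (t + r) / (2 * r).
have s0 : 0 <= s by rewrite divr_ge0//; lra.
have s1 : s <= 1 by rewrite ler_pdivrMr; lra.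
have -> : t *: v = s *: (r *: v) + (1 - s) *: ((- r) *: v).
  rewrite !scalerA -scalerDl; congr (_ *: _); rewrite /s; field.
  by rewrite (gt_eqF r0).
apply: le_trans (ch _ _ _ s0 s1) _.
set M := Num.max _ _.
have h1 : h (r *: v) <= M by rewrite le_max lexx.
have h2 : h ((- r) *: v) <= M by rewrite le_max lexx orbT.
by nra.
Qed.

(** The sum is the midpoint of one doubled term and the doubled rest, so the radius doubles at each
    step of the induction; hence [r] is generalized. *)
Lemma cvx_span_bounded (I : Type) (s : seq I) (V : I -> 'rV[R]_n) h r :
  cvxfun h -> 0 < r ->
  exists B, forall c : I -> R, (forall i, `|c i| <= r) ->
    h (\sum_(i <- s) c i *: V i) <= B.
Proof.
move=> ch; elim: s r => [|i s IH] r r0.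
  by exists (h 0) => c _; rewrite big_nil.
have r20 : 0 < 2 * r by lra.
have [B1 hB1] := IH _ r20; have [B2 hB2] := cvx_line_bounded (V i) ch r20.
exists (2^-1 * B2 + (1 - 2^-1) * B1) => c hc; rewrite big_cons.
have n2 d : `|d| <= r -> `|2 * d| <= 2 * r.
  by move=> hd; rewrite normrM ger0_norm ?ler_pM2l.
have -> : c i *: V i + \sum_(j <- s) c j *: V j =
  2^-1 *: ((2 * c i) *: V i) +
  (1 - 2^-1) *: \sum_(j <- s) (2 * c j) *: V j.
  rewrite scalerA mulKf ?pnatr_eq0//; congr (_ + _).
  rewrite scaler_sumr; apply: eq_bigr => j _; rewrite scalerA; congr (_ *: _).
  by field.
have := hB1 (fun j => 2 * c j) (fun j => n2 _ (hc j)).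
have := hB2 (2 * c i) (n2 _ (hc i)).
have := ch 2^-1 ((2 * c i) *: V i) (\sum_(j <- s) (2 * c j) *: V j).
have p : (0 : R) <= 2^-1 by lra.
have q : (2^-1 : R) <= 1 by lra.
by move=> /(_ p q); lra.
Qed.

Variables (D : 'M[R]_n).
Hypothesis hD : sym_posdef D.
Local Notation nD := (normD D).

Lemma cvx_ball_bounded h (r : R) : cvxfun h ->
  exists B, forall x, nD x <= r -> h x <= B.
Proof.
move=> ch; have [c c0 hc] := coord_bounded hD.
have r0 : 0 < c * `|r| + 1 by rewrite ltr_wpDl// mulr_ge0.
have [B hB] := cvx_span_bounded (index_enum 'I_n) (delta_mx 0) ch r0.
exists B => x xr; rewrite (row_sum_delta x); apply: hB => i.
apply: le_trans (hc _ _) _; apply: (@le_trans _ _ (c * `|r|)); last by lra.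
by rewrite ler_wpM2l// (le_trans xr)// ler_norm.
Qed.

Lemma cvx_lipschitz h (r : R) : cvxfun h -> 0 <= r -> exists2 L : R, 0 <= L &
  forall x y, nD x <= r -> nD y <= r -> h x - h y <= L * nD (x - y).
Proof.
move=> ch r0; have [B hB] := cvx_ball_bounded (r + 1) ch.
(* Reflection through [0] turns the upper bound [B] into a lower bound. *)
have lo x : nD x <= r + 1 -> 2 * h 0 - B <= h x.
  move=> hx; have := hB (- x); rewrite normDN// => /(_ hx).
  have := ch 2^-1 x (- x); have p : (0 : R) <= 2^-1 by lra.
  have q : (2^-1 : R) <= 1 by lra.
  have -> : 2^-1 *: x + (1 - 2^-1) *: - x = 0.
    by rewrite scalerN -scalerBl (_ : _ - _ = 0) ?scale0r//; field.
  by move=> /(_ p q); lra.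
have B0 : h 0 <= B by apply: hB; rewrite normD0//; lra.
exists (2 * B - 2 * h 0) => [|x y hx hy]; first by lra.
have [->|xy] := eqVneq x y; first by rewrite !subrr normD0// mulr0.
set d := nD (x - y).
have d0 : 0 < d by rewrite lt_neqAle normD_ge0 eq_sym normD_eq0// subr_eq0 xy.
(* [u] lies at distance one beyond [x] on the ray from [y], and [x] is the combination of [u] and
   [y] with weight [d / (1 + d)]. *)
set u := x + d^-1 *: (x - y).
have hu : nD u <= r + 1.
  apply: le_trans (ler_normDD hD _ _) _; rewrite lerD// normDZ// -/d.
  by rewrite ger0_norm ?invr_ge0 ?(ltW d0)// mulVf// lt0r_neq0.
set s := d / (1 + d).
have s0 : 0 <= s by rewrite divr_ge0//; lra.
have s1 : s <= 1 by rewrite ler_pdivrMr; lra.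
have xE : x = s *: u + (1 - s) *: y.
  have ne1 : 1 + d != 0 by apply: lt0r_neq0; lra.
  have ne2 : d != 0 by apply: lt0r_neq0.
  apply/rowP => i; rewrite !mxE /s; field.
  by rewrite ne1 ne2.
have := ch s u y s0 s1; rewrite -xE => h1.
have h2 : h u - h y <= 2 * B - 2 * h 0.
  have := hB _ hu; have : nD y <= r + 1 by lra.
  by move=> /lo; lra.
have sd : s <= d by rewrite ler_pdivrMr; nra.
apply: (@le_trans _ _ (s * (2 * B - 2 * h 0))); last first.
  by rewrite mulrC ler_wpM2l//; lra.
apply: (@le_trans _ _ (s * (h u - h y))); first by lra.
by rewrite ler_wpM2l.
Qed.

(** The Lipschitz bound holds in the unit ball around [x]; convexity along the segment from [x]
    carries it from the point at distance one to a farther [y]. *)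
Lemma cvx_lower_bound h x : cvxfun h -> exists2 L : R, 0 <= L &
  forall y, h x - L * nD (y - x) <= h y.
Proof.
move=> ch; have r0 : 0 <= nD x + 1 by rewrite addr_ge0 ?normD_ge0.
have [L L0 hL] := cvx_lipschitz ch r0; exists L => // y.
set d := nD (y - x).
have near1 u : nD (u - x) <= 1 -> h x - L * nD (u - x) <= h u.
  move=> hu; have := hL x u; rewrite (distDC hD x).
  have -> : nD x <= nD x + 1 by lra.
  have -> : nD u <= nD x + 1.
    rewrite -{1}(subrK x u) addrC; apply: le_trans (ler_normDD hD _ _) _; lra.
  by move=> /(_ isT isT); lra.
have [d1|d1] := leP d 1; first exact: near1.
have d0 : 0 < d by lra.
have := near1 (d^-1 *: y + (1 - d^-1) *: x).
have -> : d^-1 *: y + (1 - d^-1) *: x - x = d^-1 *: (y - x).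
  by apply/rowP => i; rewrite !mxE; ring.
rewrite normDZ// -/d ger0_norm ?invr_ge0 ?(ltW d0)// mulVf ?lt0r_neq0//.
move=> /(_ (lexx _)).
have i1 : d^-1 <= 1 by rewrite invf_le1 // ltW.
have i0 : 0 <= d^-1 by rewrite invr_ge0 ltW.
have := ch d^-1 y x i0 i1 => h1 h2.
have : d * (h x - L) <= d * (d^-1 * h y + (1 - d^-1) * h x).
  by rewrite ler_pM2l// mulr1 in h2 *; lra.
have -> : d * (d^-1 * h y + (1 - d^-1) * h x) = h y + (d - 1) * h x.
  by field; rewrite lt0r_neq0.
by lra.
Qed.

Lemma normD_sqr_conv (t : R) u v : nD (t *: u + (1 - t) *: v) ^+ 2 =
  t * nD u ^+ 2 + (1 - t) * nD v ^+ 2 - t * (1 - t) * nD (u - v) ^+ 2.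
Proof.
rewrite !(normD_sqr hD) !(dotDDl hD) !(dotDDr hD) !(dotDNl hD) !(dotDNr hD).
rewrite !(dotDZl hD) !(dotDZr hD) (dotDC hD v u).
by move: (dotD D u u) (dotD D u v) (dotD D v v) => p q r; ring.
Qed.

Lemma cvxfun_normD_sqr (a : R) x :
  0 <= a -> cvxfun (fun y => a * nD (y - x) ^+ 2).
Proof.
move=> a0 t y z t0 t1.
have -> : t *: y + (1 - t) *: z - x = t *: (y - x) + (1 - t) *: (z - x).
  by apply/rowP => i; rewrite !mxE; ring.
rewrite normD_sqr_conv.
have : 0 <= a * (t * (1 - t) * nD (y - x - (z - x)) ^+ 2).
  by rewrite mulr_ge0// mulr_ge0 ?sqr_ge0// mulr_ge0// subr_ge0.
lra.
Qed.

(* A minimizing sequence is Cauchy by strong convexity. *)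
Lemma prox_minimizer_exists h x : cvxfun h ->
  exists y, minimizer (fun y => h y + 2^-1 * nD (y - x) ^+ 2) y.
Proof.
move=> ch; set phi := fun y => _ + _.
have cphi : cvxfun phi by apply: cvxfunD ch _; apply: cvxfun_normD_sqr; lra.
pose E := [set phi y | y in [set: 'rV[R]_n]].
have [L L0 hL] := cvx_lower_bound x ch.
have Elb : has_lbound E.
  exists (h x - 2^-1 * L ^+ 2) => _ [y _ <-].
  rewrite /phi; have := hL y; have := sqr_ge0 (nD (y - x) - L).
  by rewrite sqrrB; lra.
have Einf : has_inf E by split => //; exists (phi x), x.
set m := inf E.
have mle y : m <= phi y by apply: ge_inf => //; exists y.
have ex k : exists y, phi y < m + k.+1%:R^-1.
  have k0 : 0 < k.+1%:R^-1 :> R by rewrite invr_gt0 ltr0n.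
  by have [_ [y _ <-] hy] := inf_adherent k0 Einf; exists y.
have [y hy] := choice ex.
(* At the midpoint of [a] and [b], strong convexity bounds their distance by their excess over the
   infimum [m]. *)
have mid a b : nD (a - b) ^+ 2 <= 4 * (phi a + phi b - 2 * m).
  have := mle (2^-1 *: a + (1 - 2^-1) *: b).
  have p : (0 : R) <= 2^-1 by lra.
  have q : (2^-1 : R) <= 1 by lra.
  have := ch 2^-1 a b p q; rewrite /phi.
  have -> : 2^-1 *: a + (1 - 2^-1) *: b - x =
    2^-1 *: (a - x) + (1 - 2^-1) *: (b - x).
    by apply/rowP => i; rewrite !mxE; field.
  rewrite normD_sqr_conv.
  have -> : a - x - (b - x) = a - b by rewrite opprB addrA subrK.
  by lra.
have [c c0 hc] := coord_bounded hD.
have cy : cvg (y @ \oo).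
  apply/cauchy_cvgP/cauchy_exP => e e0.
  have d0 : 0 < e ^+ 2 / (8 * (c ^+ 2 + 1)).
    by rewrite divr_gt0 ?exprn_gt0// mulr_gt0// ltr_wpDl// sqr_ge0.
  have [K _ hK] := near_infty_natSinv_lt (PosNum d0).
  have {}hK k : (K <= k)%N -> phi (y k) < m + e ^+ 2 / (8 * (c ^+ 2 + 1)).
    by move=> kK; apply: lt_trans (hy k) _; rewrite ltrD2l; apply: hK.
  exists (y K), K => // k /= kK; split => // i j; rewrite ord1 /ball /=.
  have hcK := hc (y K - y k) j; rewrite !mxE in hcK.
  apply: le_lt_trans hcK _.
  rewrite -ltr_sqr ?nnegrE ?(ltW e0) ?mulr_ge0 ?normD_ge0// exprMn.
  apply: le_lt_trans (ler_wpM2l (sqr_ge0 c) (mid _ _)) _.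
  have := hK _ (leqnn K); have := hK _ kK; set d := _ / _ => h1 h2.
  have -> : e ^+ 2 = 8 * (c ^+ 2 + 1) * d.
    by rewrite /d mulrC divfK// gt_eqF// mulr_gt0// ltr_wpDl// sqr_ge0.
  have : c ^+ 2 * (4 * (phi (y K) + phi (y k) - 2 * m)) <= c ^+ 2 * (8 * d).
    by rewrite ler_wpM2l ?sqr_ge0//; lra.
  have : 0 < d by [].
  lra.
exists (lim (y @ \oo)) => z; apply: le_trans (mle z).
set w := lim _.
(* This bound around the limit [w] stands in for continuity: [phi w] exceeds [phi (y k)] by at most
   [L' * nD (y k - w)]. *)
have [L' L'0 hL'] := cvx_lower_bound w cphi.
set S := \sum_(i < n) nD (delta_mx 0 i).
have S0 : 0 <= S by apply: sumr_ge0 => i _; apply: normD_ge0.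
apply/ler_addgt0Pr => e e0.
have d0 : 0 < e / 2 / (L' * S + 1).
  by rewrite !divr_gt0// ltr_wpDl// mulr_ge0.
have [K1 _ hK1] := cvg_ball cy d0.
have e20 : 0 < e / 2 by rewrite divr_gt0.
have [K2 _ hK2] := near_infty_natSinv_lt (PosNum e20).
have [_ hb] := hK1 _ (leq_maxl K1 K2); have /= hs := hK2 _ (leq_maxr K1 K2).
set k := maxn K1 K2 in hb hs.
have dist : nD (y k - w) <= e / 2 / (L' * S + 1) * S.
  rewrite (row_sum_delta (y k - w)).
  apply: le_trans (ler_normD_sum hD _) _; rewrite mulr_sumr.
  apply: ler_sum => i _; rewrite normDZ// ler_wpM2r ?normD_ge0//.
  by have := hb 0 i; rewrite /ball/= -normrN opprB !mxE => /ltW.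
have := hL' (y k); have := hy k.
have : L' * nD (y k - w) <= e / 2.
  apply: le_trans (ler_wpM2l L'0 dist) _.
  have -> : L' * (e / 2 / (L' * S + 1) * S) = (e / 2) * (L' * S / (L' * S + 1)).
    by ring.
  rewrite ger_pMr// ler_pdivrMr ?ltr_wpDl ?mulr_ge0//; lra.
move: hs => /=; set q := k.+1%:R^-1.
by lra.
Qed.

(** First-order optimality: compare [z] with points moving towards [y], divide by the step [t], and
    make the quadratic remainder negligible. *)
Lemma prox_subgradient h A a x z : cvxfun h ->
  (forall y, A y = A z + dotrv a (y - z)) ->
  minimizer (fun y => h y + A y + 2^-1 * nD (y - x) ^+ 2) z ->
  subgradient h z (- a - mulmv D (z - x)).
Proof.
move=> ch hA hz y; rewrite dotrvDl !dotrvNl (dotrvC (mulmv _ _)) -/(dotD D _ _).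
set Q := dotD D (y - z) (y - z); set e := dotD D (y - z) (z - x).
have Q0 : 0 <= Q by exact: dotD_ge0.
set P := h y - h z + dotrv a (y - z) + e.
suff P0 : 0 <= P by rewrite /P in P0; lra.
have key t : 0 < t -> t <= 1 -> 0 <= P + 2^-1 * t * Q.
  move=> t0 t1; have := hz (t *: y + (1 - t) *: z).
  have := ch t y z (ltW t0) t1; rewrite (hA (_ + _)).
  have -> : t *: y + (1 - t) *: z - z = t *: (y - z).
    by apply/rowP => i; rewrite !mxE; ring.
  have -> : t *: y + (1 - t) *: z - x = t *: (y - z) + (z - x).
    by apply/rowP => i; rewrite !mxE; ring.
  rewrite dotrvZr (normD_sqrD hD (_ *: _)) normDZ// exprMn.
  rewrite real_normK ?num_real// (dotDZl hD) (normD_sqr hD (y - z)).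
  rewrite -/Q -/e => h1 h2.
  by rewrite -(pmulr_rge0 _ t0) /P; lra.
rewrite leNgt; apply/negP => Pn.
have q1 : 0 < 1 + Q by lra.
(* For negative [P], a step with [t * (1 + Q) <= - P] makes [P + t * Q / 2] negative; the added one
   avoids dividing by zero. *)
pose t := Num.min 1 (- P / (1 + Q)).
have t0 : 0 < t by rewrite lt_min ltr01 divr_gt0 ?oppr_gt0.
have t1 : t <= 1 by rewrite ge_min lexx.
have t2 : t * (1 + Q) <= - P.
  by rewrite -ler_pdivlMr// ge_min lexx orbT.
have := key t t0 t1; nra.
Qed.

(** Test the subgradient inequality at [z] plus the unit vector along [u], which stays in the larger
    ball. *)
Lemma subgradient_dotrv_le h z g r L : 0 <= r -> nD z <= r ->
  (forall x y, nD x <= r + 1 -> nD y <= r + 1 -> h x - h y <= L * nD (x - y)) ->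
  subgradient h z g -> forall u, dotrv g u <= L * nD u.
Proof.
move=> r0 zr hL hg u; have [->|u0] := eqVneq u 0.
  by rewrite dotrv0r normD0// mulr0.
have d0 : 0 < nD u by rewrite lt_neqAle normD_ge0 eq_sym normD_eq0// u0.
set v := (nD u)^-1 *: u.
have v1 : nD v = 1.
  by rewrite normDZ// ger0_norm ?invr_ge0 ?(ltW d0)// mulVf// lt0r_neq0.
have h1 : nD (z + v) <= r + 1.
  by apply: le_trans (ler_normDD hD _ _) _; rewrite v1 lerD2r.
have h2 : nD z <= r + 1 by lra.
have := hL _ _ h1 h2; have := hg (z + v).
rewrite [z + v - z]addrC addKr v1 => h3 h4.
have : (nD u)^-1 * dotrv g u <= L by rewrite -dotrvZr -/v; lra.
by rewrite ler_pdivrMl// mulrC.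
Qed.

End Convex.

(** * Counting steps *)

Section Counting.
Variable R : realType.

(** The constraints are [s >= 0] and [s >= m - M * t]. Give the second the weight [th = m / M ^+ 2],
    at most one, and minimize over [t]. *)
Lemma quadratic_gain (m M e s t : R) : 0 < M -> 0 <= m -> m <= M ^+ 2 ->
  m <= e -> 0 <= s -> e - M * t <= s ->
  m ^+ 2 / (2 * M ^+ 2) <= 2^-1 * t ^+ 2 + s.
Proof.
move=> M0 m0 mM me s0 es.
pose th := m / M ^+ 2.
have M20 : 0 < M ^+ 2 by rewrite exprn_gt0.
have th0 : 0 <= th by rewrite divr_ge0// ltW.
have th1 : th <= 1 by rewrite ler_pdivrMr// mul1r.
have -> : m ^+ 2 / (2 * M ^+ 2) = 2^-1 * t ^+ 2 + th * (m - M * t)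
  - 2^-1 * (t - th * M) ^+ 2.
  by rewrite /th; field; rewrite lt0r_neq0.
have h1 : 0 <= (t - th * M) ^+ 2 by exact: sqr_ge0.
have h2 : th * (m - M * t) <= th * s by rewrite ler_wpM2l//; lra.
have h3 : th * s <= s by rewrite ler_piMl.
lra.
Qed.

(** Rests on [(1 - c * a) * (1 + c * a) <= 1]; it yields the sublinear rate within a series of null
    steps. *)
Lemma inv_decrease (c a b : R) : 0 < c -> 0 < a -> 0 < b ->
  b <= a - c * a ^+ 2 -> (c * a)^-1 + 1 <= (c * b)^-1.
Proof.
move=> c0 a0 b0 h.
have ca0 : 0 < c * a by rewrite mulr_gt0.
have cb0 : 0 < c * b by rewrite mulr_gt0.
have -> : (c * a)^-1 + 1 = (1 + c * a) / (c * a).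
  by field; rewrite !lt0r_neq0.
rewrite ler_pdivrMr// ler_pdivlMl//.
have h1 : c * b * (1 + c * a) <= c * (a - c * a ^+ 2) * (1 + c * a).
  by rewrite ler_pM2r ?ler_pM2l//; lra.
apply: le_trans h1 _; rewrite -subr_ge0.
have -> : c * a - c * (a - c * a ^+ 2) * (1 + c * a) = (c * a) ^+ 3 by ring.
by rewrite exprn_ge0// ltW.
Qed.

(* Potential: each null step raises [(c * w k)^-1] by at least one, and each
   descent step loses at most [2 / (c * eps)] of it. *)
Lemma descent_steps_bound (beta eps c sigma : R) (w Delta : nat -> R) K :
  0 < eps -> 0 < c -> 0 <= sigma -> sigma <= 1 -> (forall k, 0 <= Delta k) ->
  (forall k, (k <= K)%N -> eps / 2 <= w k) ->
  (forall k, (k < K)%N ->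
    Delta k.+1 = Delta k /\ w k.+1 <= w k - c * w k ^+ 2 \/
    Delta k.+1 <= (1 - sigma) * Delta k /\
    Delta k.+1 <= Delta k - beta * eps) ->
  exists d : nat,
    K%:R <= d%:R * (1 + 2 / (c * eps)) + (c * w K)^-1 /\
    (d = 0%N \/ beta * eps <= (1 - sigma) ^+ d.-1 * Delta 0%N).
Proof.
move=> e0 c0 s0 s1 D0 hw hs.
(* The induction also carries the geometric bound on [Delta K], which supplies the last disjunct at
   each new descent step. *)
suff : exists d : nat, [/\ K%:R <= d%:R * (1 + 2 / (c * eps)) + (c * w K)^-1,
    Delta K <= (1 - sigma) ^+ d * Delta 0%N &
    (d = 0%N \/ beta * eps <= (1 - sigma) ^+ d.-1 * Delta 0%N)].
  by move=> [d [? _ ?]]; exists d.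
elim: K hw hs => [|K IH] hw hs.
  exists 0%N; split; [|by rewrite expr0 mul1r|by left].
  rewrite mul0r add0r invr_ge0 mulr_ge0//; first exact: ltW.
  by apply: le_trans (hw 0%N isT); rewrite divr_ge0// ltW.
have [||d [hd hD hd0]] := IH.
- by move=> k kK; apply: hw; apply: leqW.
- by move=> k kK; apply: hs; apply: leqW.
have e20 : 0 < eps / 2 by rewrite divr_gt0.
have w0 : 0 < w K by apply: lt_le_trans (hw K (leqnSn K)).
have w1 : 0 < w K.+1 by apply: lt_le_trans (hw K.+1 (leqnn _)).
have ce0 : 0 < c * eps by rewrite mulr_gt0.
have [[hD1 hw1]|[hD1 hD2]] := hs K (leqnn _).
  exists d; split => //; last by rewrite hD1.
  rewrite -natr1; have := inv_decrease c0 w0 w1 hw1; lra.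
exists d.+1; split.
- have : (c * w K)^-1 <= 2 / (c * eps).
    rewrite -[2 / _]invf_div lef_pV2 ?posrE ?mulr_gt0 ?invr_gt0//.
    rewrite -mulrA ler_pM2l//; exact: hw.
  have : 0 < (c * w K.+1)^-1 by rewrite invr_gt0 mulr_gt0.
  by rewrite -!natr1 mulrDl mul1r; lra.
- apply: le_trans hD1 _; rewrite exprS -mulrA ler_wpM2l//; lra.
- by right => /=; apply: le_trans hD; have := D0 K.+1; lra.
Qed.

(** From [1 - sigma <= expR (- sigma)], after taking logarithms. *)
Lemma log_iteration_bound (eps sigma E : R) (m : nat) :
  0 < eps -> 0 < E -> 0 < sigma -> sigma <= 1 ->
  eps <= (1 - sigma) ^+ m * E -> sigma * m%:R <= ln E + ln eps^-1.
Proof.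
move=> e0 E0 s0 s1 h.
have : expR (sigma * m%:R) <= E * eps^-1.
  have h1 : (1 - sigma) ^+ m <= expR (- (sigma * m%:R)).
    have -> : - (sigma * m%:R) = m%:R * (- sigma) by rewrite mulrN mulrC.
    rewrite expRM_natl lerXn2r ?nnegrE ?expR_ge0//; first by lra.
    exact: expR_ge1Dx.
  rewrite ler_pdivlMr//.
  apply: le_trans (ler_wpM2l (expR_ge0 _) h) _.
  rewrite mulrA ger_pMl//.
  apply: le_trans (ler_wpM2l (expR_ge0 _) h1) _.
  by rewrite -expRD subrr expR0.
rewrite -lnM ?posrE ?invr_gt0// => h1.
by rewrite -ler_expR lnK// posrE divr_gt0.
Qed.

(** The first factor bounds [d + 3] per unit of [ln eps^-1], where [ln 2 <= ln eps^-1] absorbs the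
    additive constants; the second bounds the length of a series per unit of [eps^-1]. *)
Definition rate_constant (c sigma E : R) : R :=
  ((4 + ln E / sigma) / ln 2 + sigma^-1) * (1 + 2 / c).

(** The offset [3] leaves room for the last, unfinished series of null steps and for counting
    iterations instead of transitions. *)
Lemma iteration_bound (eps c sigma E : R) (d : nat) :
  0 < eps -> eps <= 2^-1 -> 0 < c -> 1 <= E -> 0 < sigma -> sigma <= 1 ->
  (d = 0%N \/ eps <= (1 - sigma) ^+ d.-1 * E) ->
  (d%:R + 3) * (1 + 2 / (c * eps)) <=
    rate_constant c sigma E * eps^-1 * ln eps^-1.
Proof.
move=> e0 e1 c0 E1 s0 s1 hd.
have E0 : 0 < E by lra.
set l := ln eps^-1.
have l20 : 0 < ln (2 : R) by rewrite ln_gt0// ltr1n.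
have l2 : ln 2 <= l.
  rewrite ler_ln ?posrE ?invr_gt0//; rewrite -[2]invrK lef_pV2 ?posrE//.
have lE : 0 <= ln E by exact: ln_ge0.
have hd3 : d%:R + 3 <= ((4 + ln E / sigma) / ln 2 + sigma^-1) * l.
  have h1 : 4 + ln E / sigma <= (4 + ln E / sigma) / ln 2 * l.
    rewrite -mulrA ler_peMr//; first by rewrite addr_ge0// divr_ge0// ltW.
    by rewrite mulrC ler_pdivlMr// mul1r.
  have h2 : d%:R <= 1 + (ln E / sigma + sigma^-1 * l).
    have p : 0 <= ln E / sigma + sigma^-1 * l.
      rewrite addr_ge0 ?mulr_ge0 ?invr_ge0 ?(ltW s0)//; lra.
    have [->|hde] := hd; first by rewrite addr_ge0.
    have := log_iteration_bound e0 E0 s0 s1 hde.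
    case: (d) p => [|m] p /=; first by move=> _; rewrite addr_ge0.
    rewrite -/l mulrC -ler_pdivlMr// -natr1 mulrDl [l / _]mulrC; lra.
  lra.
have hA : 1 + 2 / (c * eps) <= (1 + 2 / c) * eps^-1.
  have : 1 <= eps^-1 by rewrite invf_ge1//; lra.
  have -> : 2 / (c * eps) = 2 / c * eps^-1 by field; rewrite !lt0r_neq0.
  by move=> h; rewrite (mulrDl 1 (2 / c)) mul1r lerD2r.
have A0 : 0 <= 1 + 2 / (c * eps) by rewrite addr_ge0// divr_ge0// ltW ?mulr_gt0.
apply: (@le_trans _ _ (((4 + ln E / sigma) / ln 2 + sigma^-1) * l *
   ((1 + 2 / c) * eps^-1))); first by rewrite ler_pM// addr_ge0.
by rewrite /rate_constant le_eqVlt; apply/orP; left; apply/eqP; ring.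
Qed.

Lemma rate_constant_gt0 (c sigma E : R) :
  0 < c -> 1 <= E -> 0 < sigma -> 0 < rate_constant c sigma E.
Proof.
move=> c0 E1 s0; rewrite mulr_gt0//; last by rewrite addr_gt0// divr_gt0.
have l20 : 0 < ln (2 : R) by rewrite ln_gt0// ltr1n.
rewrite addr_gt0 ?invr_gt0// divr_gt0// ltr_wpDr//.
by rewrite divr_ge0 ?ln_ge0// ltW.
Qed.

End Counting.

(** * Linearized models and the proximal subproblem *)

Section Models.
Variables (R : realType) (n N : nat) (D : 'M[R]_n).
Variable f : 'I_N -> 'rV[R]_n -> R.
Hypotheses (hD : sym_posdef D) (cf : forall i, cvxfun (f i)).
Implicit Types (x y t : 'rV[R]_n) (z g : 'I_N -> 'rV[R]_n) (j : 'I_N).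
Local Notation nD := (normD D).
Local Notation F := (Fsum f).
Local Notation lin := (linearization f).

(** Unlike [Fmodel], this linearizes the selected function as well. *)
Definition lin_model z g y := \sum_i lin z g i y.

Lemma linearizationB z g i y t :
  lin z g i y = lin z g i t + dotrv (g i) (y - t).
Proof. by rewrite /linearization !dotrvBr; ring. Qed.

Lemma sum_linearizationB (P : pred 'I_N) z g y t :
  \sum_(i | P i) lin z g i y =
  \sum_(i | P i) lin z g i t + dotrv (\sum_(i | P i) g i) (y - t).
Proof.
rewrite dotrv_suml -big_split; apply: eq_bigr => i _.
exact: linearizationB.
Qed.

Lemma linearization_le z g i y :
  subgradient (f i) (z i) (g i) -> lin z g i y <= f i y.
Proof. by apply. Qed.

Lemma cvxfun_Fsum : cvxfun F.
Proof.
move=> t x y t0 t1; rewrite /Fsum !mulr_sumr -big_split /=.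
by apply: ler_sum => i _; apply: cf.
Qed.

Lemma Fmodel_eq j z g z' g' y :
  (forall i, i != j -> z i = z' i /\ g i = g' i) ->
  Fmodel f j z g y = Fmodel f j z' g' y.
Proof.
move=> h; congr (_ + _); apply: eq_bigr => i /h[e1 e2].
by rewrite /linearization e1 e2.
Qed.

Lemma FmodelE j z g y :
  Fmodel f j z g y = lin_model z g y + (f j y - lin z g j y).
Proof. by rewrite /Fmodel /lin_model [in RHS](bigD1 j)//=; ring. Qed.

Lemma FsumE j z g y :
  F y = Fmodel f j z g y + \sum_(i < N | i != j) (f i y - lin z g i y).
Proof.
by rewrite /Fmodel /Fsum (bigD1 j)//= sumrB; ring.
Qed.

Lemma lin_model_le z g y :
  (forall i, subgradient (f i) (z i) (g i)) -> lin_model z g y <= F y.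
Proof. by move=> h; apply: ler_sum => i _; apply: linearization_le. Qed.

Definition prox_obj j z g x y := Fmodel f j z g y + 2^-1 * nD (y - x) ^+ 2.

Lemma prox_obj_minimizer j z g x : exists t, minimizer (prox_obj j z g x) t.
Proof.
apply: prox_minimizer_exists => //; apply: cvxfunD => //.
apply: (@cvxfun_affine _ _ _ 0) => y; exact: sum_linearizationB.
Qed.

Lemma prox_obj_subgradient j z g x t : minimizer (prox_obj j z g x) t ->
  subgradient (f j) t (- (\sum_(i < N | i != j) g i) - mulmv D (t - x)).
Proof.
apply: prox_subgradient => // y; exact: sum_linearizationB.
Qed.

Section Trial.
Variables (j : 'I_N) (z g : 'I_N -> 'rV[R]_n) (x : 'rV[R]_n).
Hypothesis hg :
  g j = - (\sum_(i < N | i != j) g i) - mulmv D (z j - x).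

(** By [hg] the total slope is [- D (z j - x)], and the linearization of [f j] is exact at its base
    point [z j]. *)
Lemma lin_model_trial y : lin_model z g y =
  Fmodel f j z g (z j) - dotD D (z j - x) (y - z j).
Proof.
rewrite /lin_model (bigD1 j)//= {1}/linearization hg /Fmodel.
rewrite (sum_linearizationB _ z g y (z j)) dotrvDl !dotrvNl.
rewrite (dotrvC (mulmv _ _)) -/(dotD D _ _) (dotDC hD (y - _)); ring.
Qed.

(* The trial point also minimizes the fully linearized proximal objective. *)
Lemma lin_model_prox y : lin_model z g y + 2^-1 * nD (y - x) ^+ 2 =
  prox_obj j z g x (z j) + 2^-1 * nD (y - z j) ^+ 2.
Proof.
rewrite lin_model_trial /prox_obj.
have -> : y - x = (y - z j) + (z j - x) by rewrite addrA subrK.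
rewrite (normD_sqrD hD (y - z j)) (dotDC hD (y - z j)); lra.
Qed.

Hypothesis sub : forall i, subgradient (f i) (z i) (g i).

Lemma prox_obj_gap : 2^-1 * nD (z j - x) ^+ 2 <= F x - prox_obj j z g x (z j).
Proof.
have := lin_model_prox x; rewrite subrr normD0// expr0n mulr0 addr0.
rewrite (distDC hD x); have := lin_model_le x sub; lra.
Qed.

(** Move from [x] towards [xs] by the fraction [s], the minimum of [1] and [alpha]: convexity gains
    [s] times the excess of [F], and by growth the quadratic term costs at most half of that. *)
Lemma prox_obj_growth xs (alpha : R) : 0 < alpha ->
  alpha * nD (x - xs) ^+ 2 <= F x - F xs ->
  2^-1 * Num.min 1 alpha * (F x - F xs) <= F x - prox_obj j z g x (z j).
Proof.
move=> a0 hgr; pose s := Num.min 1 alpha.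
have s0 : 0 < s by rewrite lt_min ltr01.
have s1 : s <= 1 by rewrite ge_min lexx.
have sa : s <= alpha by rewrite ge_min lexx orbT.
have := lin_model_prox (s *: xs + (1 - s) *: x).
have -> : s *: xs + (1 - s) *: x - x = s *: (xs - x).
  by apply/rowP => i; rewrite !mxE; ring.
rewrite normDZ// exprMn real_normK ?num_real// (distDC hD xs).
have := lin_model_le (s *: xs + (1 - s) *: x) sub.
have := cvxfun_Fsum xs x (ltW s0) s1.
set y := _ + _; have := sqr_ge0 (nD (y - z j)).
have h : s * (s * nD (x - xs) ^+ 2) <= s * (F x - F xs).
  by rewrite ler_pM2l//; apply: le_trans hgr; rewrite ler_wpM2r// sqr_ge0.
rewrite -/s; lra.
Qed.

(** Restoring the true [f j'] adds its linearization error; this measures the rise of the optimal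
    value after a null step. *)
Lemma next_prox_obj j' t : prox_obj j' z g x t =
  prox_obj j z g x (z j) + 2^-1 * nD (t - z j) ^+ 2 +
  (f j' t - lin z g j' t).
Proof. by rewrite -lin_model_prox /prox_obj FmodelE; ring. Qed.

(** With the center moved to [z j], the slope [- D (z j - x)] and the quadratic term complete to a
    square. *)
Lemma descent_prox_obj j' t :
  Fmodel f j z g (z j) - 2^-1 * nD (z j - x) ^+ 2 <= prox_obj j' z g (z j) t.
Proof.
rewrite /prox_obj (FmodelE j') lin_model_trial.
have := linearization_le t (sub j').
have := sqr_ge0 (nD ((t - z j) + - (z j - x))).
rewrite (normD_sqrD hD (t - z j) (- (z j - x))) normDN// (dotDNr hD).
rewrite (dotDC hD (t - _)); lra.
Qed.

End Trial.
End Models.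

(** * Runs of the algorithm *)

Section RunExistence.
Variables (R : realType) (n N : nat) (D : 'M[R]_n).
Variables (f : 'I_N -> 'rV[R]_n -> R) (beta eps : R).
Hypotheses (hN : (2 <= N)%N) (hD : sym_posdef D) (cf : forall i, cvxfun (f i)).

Lemma max_other_index (e : 'I_N -> R) (j : 'I_N) :
  exists j', j' != j /\ forall i, i != j -> e i <= e j'.
Proof.
have [i0 hi0] : exists i0, i0 != j.
  have [] := pickP (fun i => i != j) => [i0 h|h]; first by exists i0.
  have := cardC1 j; rewrite card_ord (eq_card (B := pred0)) ?card0.
    by have : (0 < N.-1)%N; [rewrite -ltnS (ltn_predK hN)|case: N.-1].
  by move=> i; rewrite !inE h.
case: (@arg_maxP _ _ _ i0 (fun i => i != j) e hi0) => j' h h'.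
by exists j'; split => // i hi; apply: h'.
Qed.

(** Makes statements about all runs non-vacuous. The sequences are built for every [k], past any
    stop, by choosing a minimizer [T] and an index [J] for each state. *)
Lemma slin_run_exists x1 j1 z1 g1 :
  exists x j z g, slin_run f D beta eps x1 j1 z1 g1 x j z g.
Proof.
pose S := (('rV[R]_n * 'I_N) * (('I_N -> 'rV[R]_n) * ('I_N -> 'rV[R]_n)))%type.
have exT (s : S) :
    exists t, minimizer (prox_obj D f s.1.2 s.2.1 s.2.2 s.1.1) t.
  exact: prox_obj_minimizer.
have [T hT] := choice exT.
have exJ (s : S) : exists j', j' != s.1.2 /\ forall i, i != s.1.2 ->
    f i (s.2.1 s.1.2) - linearization f s.2.1 s.2.2 i (s.2.1 s.1.2) <=
    f j' (s.2.1 s.1.2) - linearization f s.2.1 s.2.2 j' (s.2.1 s.1.2).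
  exact: (max_other_index (fun i => f i _ - linearization f _ _ i _)).
have [J hJ] := choice exJ.
pose solve (s : S) : S := (s.1,
  (fun i => if i == s.1.2 then T s else s.2.1 i,
   fun i => if i == s.1.2 then
     - (\sum_(i < N | i != s.1.2) s.2.2 i) - mulmv D (T s - s.1.1)
     else s.2.2 i)).
pose center (s : S) :=
  if Fsum f (s.2.1 s.1.2) <= Fsum f s.1.1 -
    beta * (Fsum f s.1.1 - Fmodel f s.1.2 s.2.1 s.2.2 (s.2.1 s.1.2))
  then s.2.1 s.1.2 else s.1.1.
pose st := fix st k : S := if k is k'.+1
  then solve ((center (st k'), J (st k')), (st k').2)
  else solve ((x1, j1), (z1, g1)).
(* [pre k] is the state before Step 1, which differs from [st k] only at the selected index. *)
have [pre hpre] : exists pre : nat -> S, forall k, st k = solve (pre k).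
  exists (fun k => if k is k'.+1 then ((center (st k'), J (st k')), (st k').2)
                   else ((x1, j1), (z1, g1))).
  by case.
have keepz k i : i != (st k).1.2 -> (st k).2.1 i = (pre k).2.1 i.
  by rewrite hpre /= => /negbTE ->.
have keepg k i : i != (st k).1.2 -> (st k).2.2 i = (pre k).2.2 i.
  by rewrite hpre /= => /negbTE ->.
exists (fun k => (st k).1.1), (fun k => (st k).1.2), (fun k => (st k).2.1),
  (fun k => (st k).2.2); split.
- by [].
- by [].
- by move=> i hi; rewrite /= (negbTE hi).
- move=> k _; rewrite /trial /model_at => y.
  have e u : Fmodel f (st k).1.2 (st k).2.1 (st k).2.2 u =
      Fmodel f (pre k).1.2 (pre k).2.1 (pre k).2.2 u.
    transitivity (Fmodel f (st k).1.2 (pre k).2.1 (pre k).2.2 u).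
      by apply: Fmodel_eq => i hi; rewrite keepz ?keepg.
    by rewrite hpre.
  rewrite !e; have := hT (pre k) y; rewrite /prox_obj.
  by rewrite hpre /= eqxx.
- move=> k _; rewrite /trial.
  rewrite (eq_bigr (fun i => (pre k).2.2 i)); last exact: keepg.
  by rewrite hpre /= eqxx.
- by [].
- by move=> k _; exact: (hJ (st k)).
- by move=> k _ i /= /negbTE ->.
Qed.

End RunExistence.

(** * Gaps and subgradients along a run *)

Section Run.
Variables (R : realType) (n N : nat) (D : 'M[R]_n).
Variables (f : 'I_N -> 'rV[R]_n -> R) (beta eps : R).
Variables (x1 : 'rV[R]_n) (j1 : 'I_N) (z1 g1 : 'I_N -> 'rV[R]_n).
Variables (x : nat -> 'rV[R]_n) (j : nat -> 'I_N).
Variables (z g : nat -> 'I_N -> 'rV[R]_n).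
Hypotheses (hD : sym_posdef D) (cf : forall i, cvxfun (f i)).
Hypothesis hg1 : forall i, i != j1 -> subgradient (f i) (z1 i) (g1 i).
Hypothesis run : slin_run f D beta eps x1 j1 z1 g1 x j z g.
Hypotheses (beta0 : 0 < beta) (beta1 : beta < 1).

Local Notation nD := (normD D).
Local Notation F := (Fsum f).
Local Notation lin k := (linearization f (z k) (g k)).
Local Notation reached := (reached f eps x j z g).
Local Notation gap := (gap f x j z g).
Local Notation T k := (z k (j k)).

(** Unlike [gap], it keeps the proximal term, and so is nonincreasing over null steps. *)
Definition prox_gap k := F (x k) - prox_obj D f (j k) (z k) (g k) (x k) (T k).
Local Notation w := prox_gap.

Lemma gapE k : gap k = w k + 2^-1 * nD (T k - x k) ^+ 2.
Proof. by rewrite /w /gap /model_at /trial /prox_obj; ring. Qed.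

Lemma reachedW k : reached k.+1 -> reached k.
Proof. by move=> h l lk; apply: h; apply: leqW. Qed.

Lemma reached_gap_gt k : reached k.+1 -> eps < gap k.
Proof. by move=> h; rewrite ltNge; apply/negP; apply: h. Qed.

Lemma run_formula k : reached k ->
  g k (j k) = - (\sum_(i < N | i != j k) g k i) - mulmv D (T k - x k).
Proof. exact: run_trial_subgrad run _. Qed.

(** An entry changes only when its index is selected, and then optimality of the trial point makes
    the new one a subgradient. *)
Lemma run_subgradient k : reached k ->
  forall i, subgradient (f i) (z k i) (g k i).
Proof.
have trial_sub l : reached l -> subgradient (f (j l)) (z l (j l)) (g l (j l)).
  move=> hl; rewrite run_formula//; apply: prox_obj_subgradient => //.
  exact: run_trial run _ hl.
elim: k => [|k IH] hk i.
  have [->|ij] := eqVneq i (j 0%N); first exact: trial_sub.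
  rewrite (run_j0 run) in ij; have [-> ->] := run_zg0 run ij; exact: hg1.
have [->|ij] := eqVneq i (j k.+1); first exact: trial_sub.
by have [-> ->] := run_keep run hk ij; apply/IH/reachedW.
Qed.

Lemma half_step_le k : reached k -> 2^-1 * nD (T k - x k) ^+ 2 <= w k.
Proof.
move=> hk; apply: prox_obj_gap => //; [exact: run_formula|].
exact: run_subgradient.
Qed.

(** The quadratic part of [gap k] is at most [w k], so [gap k <= 2 * w k]. *)
Lemma prox_gap_gt k : reached k.+1 -> eps / 2 < w k.
Proof.
move=> hk; have := reached_gap_gt hk; rewrite gapE.
have := half_step_le (reachedW hk); lra.
Qed.

Lemma prox_obj_keep k y t : reached k.+1 ->
  prox_obj D f (j k.+1) (z k.+1) (g k.+1) y t =
  prox_obj D f (j k.+1) (z k) (g k) y t.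
Proof.
move=> hk; congr (_ + _); apply: Fmodel_eq => i; exact: run_keep run _ hk i.
Qed.

Lemma null_prox_gap k : reached k.+1 -> x k.+1 = x k ->
  w k.+1 = w k - 2^-1 * nD (T k.+1 - T k) ^+ 2 -
    (f (j k.+1) (T k.+1) - lin k (j k.+1) (T k.+1)).
Proof.
move=> hk hx; rewrite /w prox_obj_keep// hx.
by rewrite (next_prox_obj f hD (run_formula (reachedW hk))); ring.
Qed.

Lemma null_prox_gap_le k : reached k.+1 -> x k.+1 = x k -> w k.+1 <= w k.
Proof.
move=> hk hx; rewrite null_prox_gap//.
have := linearization_le (T k.+1) (run_subgradient (reachedW hk) (j k.+1)).
have := sqr_ge0 (nD (T k.+1 - T k)); lra.
Qed.

(** A descent step may increase [w]; this estimate keeps [w] bounded along the run. *)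
Lemma descent_prox_gap k : reached k.+1 -> x k.+1 = T k ->
  F (T k) <= F (x k) - beta * gap k ->
  w k.+1 <= (1 - beta) * gap k + 2^-1 * nD (T k - x k) ^+ 2.
Proof.
move=> hk hx hF; rewrite {1}/w prox_obj_keep// hx.
have := descent_prox_obj hD (run_formula (reachedW hk))
  (run_subgradient (reachedW hk)) (j k.+1) (T k.+1).
move: hF; rewrite /gap /model_at /trial; lra.
Qed.

(** Failure of the descent test puts the model error at the trial point above [(1 - beta) * gap k];
    that error is a sum of linearization errors, none larger than that of the next index. *)
Lemma null_selection k : reached k.+1 ->
  F (x k) - beta * gap k < F (T k) ->
  (1 - beta) * gap k <= N%:R * (f (j k.+1) (T k) - lin k (j k.+1) (T k)).
Proof.
move=> hk; have sub := run_subgradient (reachedW hk).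
have [jj hmax] := run_select run hk.
set e := f (j k.+1) _ - _; have e0 : 0 <= e.
  by rewrite subr_ge0; apply: linearization_le.
have : \sum_(i < N | i != j k) (f i (T k) - lin k i (T k)) <= N%:R * e.
  apply: (@le_trans _ _ (\sum_(i < N) e)).
    rewrite [leRHS](bigD1 (j k))//= ler_wpDl//.
    by apply: ler_sum => i; apply: hmax.
  by rewrite sumr_const card_ord mulr_natl.
rewrite (FsumE f (j k) (z k) (g k) (T k)) /gap /model_at /trial; lra.
Qed.

(** * Uniform bounds along a run and the gain of each step *)

Section Bounds.
Variables (xs : 'rV[R]_n) (alpha r0 W L G : R).
Hypotheses (alpha0 : 0 < alpha) (hmin : forall y, F xs <= F y).
Hypothesis growth : forall y, alpha * nD (y - xs) ^+ 2 <= F y - F xs.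
Hypothesis level : forall y, F y <= F x1 -> nD y <= r0.
Hypothesis W_init : forall t, F x1 - prox_obj D f j1 z1 g1 x1 t <= W.
Hypotheses (W0 : 0 <= W) (r0_W : 4 * r0 ^+ 2 <= beta * W).
Local Notation rho := (r0 + (1 + 2 * W)).
Hypothesis lip : forall i u v, nD u <= rho + 1 -> nD v <= rho + 1 ->
  f i u - f i v <= L * nD (u - v).
Hypotheses (L0 : 0 <= L) (LG : L <= G).
Hypothesis hG : forall i, i != j1 -> forall u, dotrv (g1 i) u <= G * nD u.

Lemma r0_ge0 : 0 <= r0.
Proof. exact: le_trans (normD_ge0 _ _) (level (lexx _)). Qed.

Lemma trial_bounded k : reached k -> F (x k) <= F x1 -> w k <= W ->
  nD (T k) <= rho.
Proof.
move=> hk hF hw; rewrite -[T k](subrK (x k)) addrC.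
apply: le_trans (ler_normDD hD _ _) _; rewrite lerD ?level//.
(* [a ^+ 2 <= 2 * W] gives [a <= 1 + 2 * W] without a square root. *)
have := half_step_le hk; set a := nD _ => ha.
have a0 : 0 <= a by exact: normD_ge0.
have := W0; nra.
Qed.

(** The first two bounds confine the trial point, so its subgradient is bounded by [L]; the other
    entries inherit the bound [G]. *)
Lemma run_bounds k : reached k -> [/\ F (x k) <= F x1, w k <= W &
  forall i u, dotrv (g k i) u <= G * nD u].
Proof.
have r00 : 0 <= rho by have := r0_ge0; have := W0; lra.
have gbound l : reached l -> F (x l) <= F x1 -> w l <= W ->
    forall u, dotrv (g l (j l)) u <= G * nD u.
  move=> hl hF hw u; apply: (@le_trans _ _ (L * nD u)).
    apply: (@subgradient_dotrv_le _ _ D hD (f (j l)) (T l) _ rho) => //.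
    - exact: trial_bounded.
    - exact: lip.
    - exact: run_subgradient.
  by rewrite ler_wpM2r// normD_ge0.
elim: k => [|k IH] hk.
  have hx := run_x0 run; have hj := run_j0 run.
  have hw : w 0 <= W.
    rewrite /w hx; apply: le_trans (W_init (T 0)); rewrite lerD2l lerN2.
    rewrite /prox_obj hj lerD2r le_eqVlt; apply/orP; left; apply/eqP.
    by apply: Fmodel_eq => i /(run_zg0 run)[-> ->].
  have hF : F (x 0%N) <= F x1 by rewrite hx.
  split => // i; have [->|ij] := eqVneq i (j 0%N); first exact: gbound.
  by rewrite hj in ij; have [_ ->] := run_zg0 run ij; apply: hG.
have hk' := reachedW hk; have [hF hw hg] := IH hk'.
have [hF' hw'] : F (x k.+1) <= F x1 /\ w k.+1 <= W.
  have := run_center run hk; rewrite /trial.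
  have [hd hx|_ hx] := leP; last first.
    by rewrite hx; split => //; apply: le_trans (null_prox_gap_le hk hx) _.
  have hF1 : F (T k) <= F (x k).
    have : 0 <= beta * gap k; last by lra.
    rewrite gapE mulr_ge0 ?(ltW beta0)// addr_ge0//.
      by apply: le_trans (half_step_le hk'); rewrite mulr_ge0 ?sqr_ge0.
    by rewrite mulr_ge0 ?sqr_ge0.
  split; first by rewrite hx; apply: le_trans hF.
  apply: le_trans (descent_prox_gap hk hx hd) _; rewrite gapE.
  (* Both centers lie in the level set, so the step is at most [2 * r0]; then [w k.+1 <= (1 - beta)
     * W + 4 * r0 ^+ 2 <= W]. *)
  have hn : nD (T k - x k) <= 2 * r0.
    apply: le_trans (ler_normDD hD _ _) _; rewrite normDN//.
    have := level (le_trans hF1 hF); have := level hF; lra.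
  have hn2 : nD (T k - x k) ^+ 2 <= 4 * r0 ^+ 2.
    have -> : 4 * r0 ^+ 2 = (2 * r0) ^+ 2 by ring.
    by rewrite lerXn2r ?nnegrE ?normD_ge0// mulr_ge0// r0_ge0.
  move: (nD _ ^+ 2) (sqr_ge0 (nD (T k - x k))) hn2 => q q0 hq.
  have := r0_W; have := beta0; have := beta1; have := W0; nra.
split => // i; have [->|ij] := eqVneq i (j k.+1); first exact: gbound.
by have [_ ->] := run_keep run hk ij; apply: hg.
Qed.

Local Notation nu := ((1 - beta) / N%:R).
Local Notation M := (L + G + 1 + W).

(** [nu * w k] bounds from below the largest linearization error at a null step, and [M] bounds the
    rate at which it can fall; the summand [1 + W] ensures [0 < M] and [W <= M ^+ 2]. *)
Definition null_gain : R := nu ^+ 2 / (2 * M ^+ 2).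
Definition descent_gain : R := beta * (2^-1 * Num.min 1 alpha).

Hypothesis N0 : (0 < N)%N.

(** The error of the new index falls by at most [M] times the distance from [T k] to [T k.+1], so
    either the error or the proximal term stays large; [quadratic_gain] weighs the two. *)
Lemma null_step_gain k : reached k.+1 -> x k.+1 = x k ->
  F (x k) - beta * gap k < F (T k) ->
  w k.+1 <= w k - null_gain * w k ^+ 2.
Proof.
move=> hk hx hF; have hk' := reachedW hk.
have [F1 w1 _] := run_bounds hk; have [F0 w0 hg] := run_bounds hk'.
have hw0 : 0 <= w k.
  by apply: le_trans (half_step_le hk'); rewrite mulr_ge0 ?sqr_ge0.
have Np : 0 < N%:R :> R by rewrite ltr0n.
have N1 : 1 <= N%:R :> R by rewrite ler1n.
have nu0 : 0 <= nu by rewrite divr_ge0 ?subr_ge0// ltW.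
have nu1 : nu <= 1 by rewrite ler_pdivrMr//; have := beta0; lra.
rewrite null_prox_gap//.
set e' := f _ _ - _; set t := nD _.
pose e := f (j k.+1) (T k) - lin k (j k.+1) (T k).
have he : nu * w k <= e.
  rewrite mulrAC ler_pdivrMr// mulrC [e * _]mulrC.
  apply: le_trans (null_selection hk hF).
  rewrite mulrC ler_wpM2l ?subr_ge0 ?(ltW beta1)//.
  by rewrite gapE lerDl mulr_ge0 ?sqr_ge0.
have e'0 : 0 <= e'.
  by rewrite subr_ge0; apply: linearization_le; apply: run_subgradient.
have t0 : 0 <= t by exact: normD_ge0.
have ee' : e - M * t <= e'.
  have h1 := trial_bounded hk F1 w1; have h2 := trial_bounded hk' F0 w0.
  have := hg (j k.+1) (T k.+1 - T k); rewrite -/t.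
  have := @lip (j k.+1) (T k) (T k.+1); rewrite distDC// -/t.
  have -> : nD (T k) <= rho + 1 by lra.
  have -> : nD (T k.+1) <= rho + 1 by lra.
  move=> /(_ isT isT).
  rewrite /e /e' (linearizationB f (z k) (g k) (j k.+1) (T k.+1) (T k)).
  have : 0 <= (1 + W) * t by rewrite mulr_ge0//; have := W0; lra.
  lra.
have LG0 : 0 <= L + G by have := L0; have := LG; lra.
have M0 : 0 < M by have := W0; lra.
have hM : nu * w k <= M ^+ 2.
  apply: (@le_trans _ _ W); first by apply: le_trans w0; rewrite ler_piMl.
  have := W0; nra.
have := quadratic_gain M0 (mulr_ge0 nu0 hw0) hM he e'0 ee'.
have -> : (nu * w k) ^+ 2 / (2 * M ^+ 2) = null_gain * w k ^+ 2.
  by rewrite /null_gain; field; rewrite !lt0r_neq0.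
lra.
Qed.

Lemma descent_gain_gt0 : 0 < descent_gain.
Proof. by rewrite !mulr_gt0 ?invr_gt0 ?lt_min ?ltr01. Qed.

Lemma descent_gain_le1 : descent_gain <= 1.
Proof.
have : Num.min 1 alpha <= 1 by rewrite ge_min lexx.
have : 0 < Num.min 1 alpha by rewrite lt_min ltr01.
rewrite /descent_gain; move: (Num.min _ _) => q.
have := beta0; have := beta1; nra.
Qed.

Lemma null_gain_gt0 : 0 < null_gain.
Proof.
have nu0 : 0 < nu by rewrite divr_gt0 ?subr_gt0 ?ltr0n.
have M0 : 0 < M by have := L0; have := LG; have := W0; lra.
by rewrite divr_gt0 ?exprn_gt0// mulr_gt0 ?exprn_gt0.
Qed.

(** In a descent step, [beta * gap k] is at least a fixed fraction of the excess by growth, and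
    exceeds [beta * eps] because the stopping test failed. *)
Lemma run_transition k : reached k.+1 ->
  F (x k.+1) - F xs = F (x k) - F xs /\ w k.+1 <= w k - null_gain * w k ^+ 2 \/
  F (x k.+1) - F xs <= (1 - descent_gain) * (F (x k) - F xs) /\
  F (x k.+1) - F xs <= F (x k) - F xs - beta * eps.
Proof.
move=> hk; have hk' := reachedW hk; have := run_center run hk; rewrite /trial.
have [hd hx|hd hx] := leP.
  2: by left; rewrite hx; split => //; apply: null_step_gain.
right; have hgap := reached_gap_gt hk.
have := prox_obj_growth hD cf (run_formula hk') (run_subgradient hk') alpha0
  (growth (x k)).
rewrite -/(w k) => hgr.
have wg : w k <= gap k by rewrite gapE lerDl mulr_ge0 ?sqr_ge0.
have h1 : beta * (2^-1 * Num.min 1 alpha * (F (x k) - F xs)) <= beta * gap k.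
  by rewrite ler_pM2l//; apply: le_trans wg.
have h2 : beta * eps <= beta * gap k by rewrite ler_pM2l// ltW.
by rewrite hx /descent_gain; split; lra.
Qed.

(** Indices start from [0]: if [0] to [K] do not stop, a stop at [K.+1] makes [K.+2] iterations. *)
Lemma run_iteration_bound K : 0 < eps -> eps <= 2^-1 -> reached K.+1 ->
  K.+2%:R <= rate_constant null_gain descent_gain (1 + (F x1 - F xs) / beta) *
    eps^-1 * ln eps^-1.
Proof.
move=> e0 e1 hK.
have hle k : (k <= K)%N -> reached k.+1.
  by move=> kK l lk; apply: hK; apply: leq_trans lk _.
have [] := @descent_steps_bound R beta eps null_gain descent_gain w
  (fun k => F (x k) - F xs) K e0 null_gain_gt0 (ltW descent_gain_gt0)
  descent_gain_le1.
- by move=> k; rewrite subr_ge0.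
- by move=> k kK; apply/ltW/prox_gap_gt/hle.
- by move=> k kK; apply/run_transition/reachedW/hle.
move=> d [hd hd0].
have D0 : 0 <= F x1 - F xs by rewrite subr_ge0.
have E1 : 1 <= 1 + (F x1 - F xs) / beta by rewrite lerDl divr_ge0// ltW.
(* Division by [beta] turns the threshold [beta * eps] into [eps]; the added one keeps the logarithm
   nonnegative. *)
have hd1 : d = 0%N \/ eps <= (1 - descent_gain) ^+ d.-1 *
    (1 + (F x1 - F xs) / beta).
  have [|h] := hd0; [by left|right].
  apply: (@le_trans _ _ ((1 - descent_gain) ^+ d.-1 * ((F x1 - F xs) / beta))).
    by rewrite mulrA ler_pdivlMr// mulrC; rewrite (run_x0 run) in h.
  rewrite ler_wpM2l ?lerDr// exprn_ge0// subr_ge0; exact: descent_gain_le1.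
apply: le_trans (iteration_bound e0 e1 null_gain_gt0 E1 descent_gain_gt0
  descent_gain_le1 hd1).
have ce0 : 0 < null_gain * eps by rewrite mulr_gt0// null_gain_gt0.
have : (null_gain * w K)^-1 <= 2 / (null_gain * eps).
  have w0 := ltW (prox_gap_gt hK).
  have e20 : 0 < eps / 2 by rewrite divr_gt0.
  rewrite -[2 / _]invf_div lef_pV2 ?posrE ?divr_gt0//.
    by rewrite -mulrA ler_pM2l// null_gain_gt0.
  by rewrite mulr_gt0 ?null_gain_gt0//; apply: lt_le_trans w0.
have : 0 < 2 / (null_gain * eps) by rewrite divr_gt0.
rewrite -!natr1; lra.
Qed.

End Bounds.
End Run.

(** * Constants common to all the functions, and bounded level sets *)

Section Boundedness.
Variables (R : realType) (n N : nat) (D : 'M[R]_n).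
Variable f : 'I_N -> 'rV[R]_n -> R.
Hypotheses (hD : sym_posdef D) (cf : forall i, cvxfun (f i)).
Local Notation nD := (normD D).

Lemma ler_bigsum (c : 'I_N -> R) i : (forall i, 0 <= c i) -> c i <= \sum_i c i.
Proof. by move=> c0; rewrite (bigD1 i)//= lerDl sumr_ge0. Qed.

Lemma family_lipschitz (r : R) : 0 <= r -> exists2 L : R, 0 <= L &
  forall i u v, nD u <= r -> nD v <= r -> f i u - f i v <= L * nD (u - v).
Proof.
move=> r0; have h i : exists L : R, 0 <= L /\
    forall u v, nD u <= r -> nD v <= r -> f i u - f i v <= L * nD (u - v).
  by have [L L0 hL] := cvx_lipschitz hD (cf i) r0; exists L.
have [L hL] := choice h; exists (\sum_i L i).
  by apply: sumr_ge0 => i _; case: (hL i).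
move=> i u v hu hv; apply: le_trans ((hL i).2 u v hu hv) _.
by rewrite ler_wpM2r ?normD_ge0//; apply: ler_bigsum => k; case: (hL k).
Qed.

Lemma family_dotrv_bounded (g : 'I_N -> 'rV[R]_n) : exists2 c : R, 0 <= c &
  forall i u, dotrv (g i) u <= c * nD u.
Proof.
have h i : exists c : R, 0 <= c /\ forall u, dotrv (g i) u <= c * nD u.
  by have [c c0 hc] := dotrv_bounded hD (g i); exists c.
have [c hc] := choice h; exists (\sum_i c i).
  by apply: sumr_ge0 => i _; case: (hc i).
move=> i u; apply: le_trans ((hc i).2 u) _.
by rewrite ler_wpM2r ?normD_ge0//; apply: ler_bigsum => k; case: (hc k).
Qed.

Lemma level_set_bounded xs (alpha b : R) : 0 < alpha ->
  (forall y, alpha * nD (y - xs) ^+ 2 <= Fsum f y - Fsum f xs) ->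
  exists r : R, forall y, Fsum f y <= b -> nD y <= r.
Proof.
move=> a0 gr; exists (nD xs + (1 + (b - Fsum f xs) / alpha)) => y hy.
rewrite -[y](subrK xs) addrC; apply: le_trans (ler_normDD hD _ _) _.
rewrite lerD2l; set a := nD _.
have : a ^+ 2 <= (b - Fsum f xs) / alpha.
  rewrite ler_pdivlMr// mulrC; apply: le_trans (gr y) _; lra.
have : 0 <= (a - 1) ^+ 2 by exact: sqr_ge0.
have : 0 <= a by exact: normD_ge0.
rewrite sqrrB1; nra.
Qed.

End Boundedness.

(** A run that never stopped would reach every [K], against the archimedean property. Otherwise take
    the least stopping index; [1 <= B] covers index [0]. *)
Lemma first_stop (R : realType) (n N : nat) (f : 'I_N -> 'rV[R]_n -> R)
  (eps B : R) x j z g :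
  1 <= B -> (forall K, reached f eps x j z g K.+1 -> K.+2%:R <= B) ->
  exists k : nat, [/\ reached f eps x j z g k, stops_at f eps x j z g k &
    k.+1%:R <= B].
Proof.
move=> B1 hB; have [[k hk]|nex] := pselect (exists k, stops_at f eps x j z g k).
  have ex : exists k, `[< stops_at f eps x j z g k >].
    by exists k; apply/asboolP.
  case: (ex_minnP ex) => m /asboolP hm min.
  have rm : reached f eps x j z g m.
    move=> l lm sl; have /min : `[< stops_at f eps x j z g l >].
      exact/asboolP.
    by rewrite leqNgt lm.
  by exists m; split => //; case: m {hm min} rm => [|m] rm //; exact: hB.
have B0 : 0 <= B by apply: le_trans B1.
have := hB (Num.bound B); have -> : (Num.bound B).+2%:R <= B = false.
  apply/negbTE; rewrite -ltNge; apply: lt_le_trans (archi_boundP B0) _.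
  by rewrite ler_nat -addn2 leq_addr.
by move=> h; have : false by apply: h => l _ hl; apply: nex; exists l.
Qed.

Theorem mainTheorem1 (R : realType) (n N : nat) (hN : (2 <= N)%N)
  (f : 'I_N -> 'rV[R]_n -> R)
  (hf : forall i, convex_function [set: convex_lmodType 'rV[R]_n] (f i))
  (D : 'M[R]_n) (hD : sym_posdef D)
  (xstar : 'rV[R]_n) (hxstar : unique (minimizer (Fsum f)) xstar)
  (alpha : R) (halpha : 0 < alpha)
  (hgrowth : forall x : 'rV[R]_n,
     alpha * normD D (x - xstar) ^+ 2 <= Fsum f x - Fsum f xstar)
  (beta : R) (hbeta0 : 0 < beta) (hbeta1 : beta < 1)
  (x1 : 'rV[R]_n) (j1 : 'I_N) (z1 g1 : 'I_N -> 'rV[R]_n)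
  (hg1 : forall i, i != j1 -> subgradient (f i) (z1 i) (g1 i)) :
  exists C' : R, 0 < C' /\
    forall eps : R, 0 < eps -> eps <= 2^-1 ->
      (exists x j z g, slin_run f D beta eps x1 j1 z1 g1 x j z g) /\
      (forall x j z g, slin_run f D beta eps x1 j1 z1 g1 x j z g ->
         exists k : nat,
           [/\ reached f eps x j z g k,
               stops_at f eps x j z g k &
               k.+1%:R <= C' * eps^-1 * ln eps^-1]).
Proof.
have cf i : cvxfun (f i) by exact: convex_function_cvxfun.
have hmin y : Fsum f xstar <= Fsum f y by exact: hxstar.1.
have [t0 ht0] := prox_obj_minimizer hD cf j1 z1 g1 x1.
set w0 := Fsum f x1 - prox_obj D f j1 z1 g1 x1 t0.
have [r0 hr0] := level_set_bounded hD (Fsum f x1) halpha hgrowth.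
(* The first summand dominates the initial gap; the second gives [4 * r0 ^+ 2 <= beta * W]. *)
pose W := `|w0| + 4 * r0 ^+ 2 / beta.
have q0 : 0 <= 4 * r0 ^+ 2 by rewrite mulr_ge0 ?sqr_ge0.
have W0 : 0 <= W by rewrite addr_ge0// divr_ge0// ltW.
have W_init t : Fsum f x1 - prox_obj D f j1 z1 g1 x1 t <= W.
  apply: (@le_trans _ _ w0); first by rewrite lerD2l lerN2; exact: ht0.
  by apply: le_trans (ler_norm _) _; rewrite lerDl divr_ge0// ltW.
have r0_W : 4 * r0 ^+ 2 <= beta * W.
  rewrite mulrDr [beta * (_ / _)]mulrC divfK ?lt0r_neq0//.
  by rewrite lerDr mulr_ge0// ltW.
have r00 : 0 <= r0 by exact: le_trans (normD_ge0 D x1) (hr0 _ (lexx _)).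
have rho0 : 0 <= r0 + (1 + 2 * W) + 1 by lra.
have [L L0 lip] := family_lipschitz hD cf rho0.
have [c c0 hc] := family_dotrv_bounded hD g1.
(* [L + c] serves as [G], dominating both the Lipschitz constant and the initial subgradients. *)
have LG : L <= L + c by rewrite lerDl.
have hG i : i != j1 -> forall u, dotrv (g1 i) u <= (L + c) * normD D u.
  move=> _ u; apply: le_trans (hc i u) _.
  by rewrite ler_wpM2r ?normD_ge0// lerDr.
have N0 : (0 < N)%N by exact: ltnW.
pose ng := null_gain N beta W L (L + c).
pose dg := descent_gain beta alpha.
pose E := 1 + (Fsum f x1 - Fsum f xstar) / beta.
have ng0 : 0 < ng by apply: null_gain_gt0.
have dg0 : 0 < dg by apply: descent_gain_gt0.
have dg1 : dg <= 1 by apply: descent_gain_le1.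
have E1 : 1 <= E by rewrite lerDl divr_ge0 ?subr_ge0// ltW.
exists (rate_constant ng dg E); split; first exact: rate_constant_gt0.
move=> eps e0 e1; split; first exact: slin_run_exists.
move=> x j z g run; apply: first_stop => [|K hK].
  (* The case of zero descent steps shows that the claimed bound is at least one. *)
  apply: le_trans (iteration_bound e0 e1 ng0 E1 dg0 dg1 (or_introl erefl)).
  rewrite add0r; have : 0 < 2 / (ng * eps) by rewrite divr_gt0// mulr_gt0.
  lra.
exact: (run_iteration_bound hD cf hg1 run hbeta0 hbeta1 halpha hmin hgrowth hr0
  W_init W0 r0_W lip L0 LG hG N0 e0 e1 hK).
Qed.
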